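(* Consider two $H$-MBQCs with a given input group $Q$ that differ in their respective phase functions, $\Phi$ versus $\Phi'$ (and hence possibly in their output functions $o$ and $o'$). If $[\Phi]=[\Phi']\in H^1(Q,\mathcal{C}_Q)$, then $[[o]]=[[o']]$.
   Context: Observables. Fix a finite-dimensional Hilbert space. $\mathcal{O}$ is a set of observables (Hermitian operators with eigenvalues $\pm1$ only) with $A\in\mathcal{O}\Leftrightarrow -A\in\mathcal{O}$. A resolution of an observable $X$ in $\mathcal{O}$ is a product $X=A_1(A_2(\cdots(A_{K-1}A_K)))$, $K\ge 1$, $A_i\in\mathcal{O}$, such that with $B_i:=\prod_{l=i+1}^K A_l$ (in this order) $[A_i,B_i]=0$ for $i=1,\dots,K-1$. $\mathcal{I}$ is the set of all observables having a resolution in $\mathcal{O}$; it is closed under $A\mapsto -A$. $E$ is the set of classes $\{A,-A\}$, $A\in\mathcal{I}$; for each $a\in E$ a representative $T_a\in\mathcal{I}$ is fixed, so $\mathcal{I}=\{\pm T_a: a\in E\}$. $E_{\mathcal{O}}:=\{a\in E: T_a\in\mathcal{O}\}$. For $a\in E_{\mathcal{O}}$, $b\in E$ with $[T_a,T_b]=0$, $a\oplus b\in E$ is defined by $T_{a\oplus b}=\pm T_aT_b$. Chain complex (coefficients $\mathbb{Z}_2$). $C_1(E)$ is freely generated by $[a]$, $a\in E$; $C_2(E)$ is freely generated by the pairs $[a|b]$ for which $a\oplus b$ is defined; $\partial[a|b]=[a]+[b]+[a\oplus b]$. For $E_0\subset E$, $C_n(E,E_0):=C_n(E)/C_n(E_0)$,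 where $C_n(E_0)$ is spanned by the generators all of whose edges lie in $E_0$; $\partial_R$ is the induced boundary. $C_1(E,E_0)$ has basis $E\setminus E_0$. Symmetry and input groups. $H$ is a group acting on the set $\mathcal{I}$ with $h(-A)=-h(A)$. The induced action on $E$ and the phase function $\tilde\Phi_h(a)\in\mathbb{Z}_2$ are defined by $h(T_a)=(-1)^{\tilde\Phi_h(a)}T_{ha}$; $\tilde\Phi_h$ is extended linearly to 1-chains. $N=\{n\in H: na=a\ \forall a\in E\}$, and the input group is $Q=H/N$, assumed finite, acting on $E$ by $[h]a=ha$. A sequence of distinct edges $a_1,\dots,a_n\in E_{\mathcal{O}}$ is fixed, $\mathcal{E}_{\rm e}=\{a_1,\dots,a_n\}$, such that $a_{\rm e}:=a_1\oplus(a_2\oplus\cdots\oplus(a_{n-1}\oplus a_n))$ is defined. $E_0:=\{qa_{\rm e}: q\in Q\}$, and $\mathcal{E}_{\rm e}\cap E_0=\emptyset$. With $b_i:=a_{i+1}\oplus(\cdots\oplus a_n)$ (so $b_{n-1}=a_n$), $f_{\rm e}$ is the image of $\sum_{i=1}^{n-1}[a_i|b_i]$ in $C_2(E,E_0)$; $\partial_R f_{\rm e}=\sum_i a_i$. For the output function $o:Q\to\mathbb{Z}_2$ let $\mathcal{R}_o:=\{(-1)^{o(q)}\prod_{i=1}^nT_{qa_i}: q\in Q\}$ (products in the order $1,\dots,n$). There is $\chi:E_0\to\mathbb{Z}_2$ with $\mathcal{R}_o=\{(-1)^{\chi(x)}T_x: x\in E_0\}$. $H$ is required to satisfy, for all $h\in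 H$: (1) $h(A)\in\mathcal{O}$ for all $A\in\mathcal{O}$; (2) $h(A)h(B)=h(AB)$ for all $A,B\in\mathcal{I}$ with $[A,B]=0$ and $AB\in\mathcal{I}$; (3) $h(\mathcal{R}_o)=\mathcal{R}_o$. Phase function on $Q$. Let $\overline\chi$ be the extension of $\chi$ to $E$ by zero, and $(\Phi_\chi)_h(a):=\tilde\Phi_h(a)+\overline\chi(ha)+\overline\chi(a)$; it vanishes for $a\in E_0$, so it is defined on $C_1(E,E_0)$. Let $C_1(\mathcal{C}_Q)\subset C_1(E,E_0)$ be the span of the chains $q\,\partial_Rf_{\rm e}$, $q\in Q$. For $x\in C_1(\mathcal{C}_Q)$, $(\Phi_\chi)_h(x)$ depends on $h$ only through $[h]\in Q$, and one sets $\Phi_{[h]}(x):=(\Phi_\chi)_h(x)$. $\Phi$ is a 1-cocycle in group cohomology: $\Phi_{q_1}(q_2x)+\Phi_{q_1q_2}(x)+\Phi_{q_2}(x)=0$. Its class $[\Phi]\in H^1(Q,\mathcal{C}_Q)$ is its class modulo coboundaries ${\tt d}\gamma$, $({\tt d}\gamma)_q(x)=\gamma(qx)+\gamma(x)$, with $\gamma:C_1(\mathcal{C}_Q)\to\mathbb{Z}_2$ linear. The two $H$-MBQCs share $E$, $E_{\mathcal{O}}$, $\oplus$, the group $Q$ with its action on $E$, and the sequence $a_1,\dots,a_n$ (hence $E_0$, $f_{\rm e}$, $C_1(\mathcal{C}_Q)$). Equivalence of output functions: $$[[o]]=\{o+\gamma(\,\cdot\,\partial_Rf_{\rm e})+c:\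 \gamma:E\setminus E_0\to\mathbb{Z}_2,\ c\in\mathbb{Z}_2\},$$ where $\gamma(\,\cdot\,\partial_Rf_{\rm e})$ is the function $q\mapsto\gamma(q\,\partial_Rf_{\rm e})=\sum_i\gamma(qa_i)$. *)

(* Defs.v *)
From HB Require Import structures.
From mathcomp Require Import fingroup.
From mathcomp Require Import all_boot all_order all_algebra generic_quotient.
From mathcomp Require Import boolp classical_sets reals.
From mathcomp Require Import complex.
From mathcomp.multinomials Require Import freeg.

Set Implicit Arguments.
Unset Strict Implicit.
Unset Printing Implicit Defensive.

Import GRing.Theory.

Local Open Scope ring_scope.
Local Open Scope quotient_scope.
Local Open Scope classical_set_scope.

(* The right-nested partial sum a_1 (+) (a_2 (+) ( ... (+) a_n)) of a nonempty
   sequence, for a partial operation [op]. *)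
Fixpoint nested_sum (E : Type) (op : E -> E -> option E) (s : seq E) : option E :=
  match s with
  | [::] => None
  | [:: a] => Some a
  | a :: s' => obind (op a) (nested_sum op s')
  end.

(* The combinatorial data of an H-MBQC, which two H-MBQCs may share: edges E, the
   subset E_O, the partial operation a (+) b (None where it is undefined), the
   finite group Q acting on E, and the sequence a_1, ..., a_n with its sum a_e. *)
Record edge_data := EdgeData {
  edge :> choiceType;
  EO : set edge;
  oplus : edge -> edge -> option edge;
  Qgrp : finGroupType;
  act : Qgrp -> edge -> edge;
  act1 : forall a, act 1%g a = a;
  actM : forall p q a, act (p * q)%g a = act p (act q a);
  ninp : nat;
  inp : ninp.-tuple edge;
  inp_uniq : uniq inp;
  inp_EO : forall i, EO (tnth inp i);
  ae : edge;
  inp_sum : nested_sum oplus inp = Some ae;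
  inp_notin_E0 : forall i q, tnth inp i != act q ae
}.

HB.instance Definition _ (R : nzRingType) (K : choiceType) (M : lmodType R)
    (f : K -> M) :=
  GRing.isZmodMorphism.Build {freeg K / R} M (fglift f) (lift_is_additive f).

Section Chains.
Variable G : edge_data.

Definition E0 : {pred G} := [pred a | [exists q, a == @act G q (ae G)]].

Definition C1 := {freeg G / 'F_2}.

Definition cell := {p : G * G | @oplus G p.1 p.2}.

Definition C2 := {freeg cell / 'F_2}.

(* The edge a (+) b of the cell [a|b]; the default value is never used. *)
Definition cell_sum (p : cell) : G :=
  odflt (val p).1 (oplus (val p).1 (val p).2).

Definition boundary : C2 -> C1 :=
  fglift (fun p : cell => << (val p).1 >> + << (val p).2 >> + << cell_sum p >> : C1).

Definition C1E0 : {pred C1} := [pred x : C1 | all [in E0] (dom x)].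

Definition C2E0 : {pred C2} := [pred x : C2 |
  all (fun p : cell => [&& (val p).1 \in E0, (val p).2 \in E0 & cell_sum p \in E0])
      (dom x)].

Lemma dom_all_zmod_closed (K : choiceType) (P : pred K) :
  zmod_closed [pred x : {freeg K / 'F_2} | all P (dom x)].
Proof.
split=> [|x y]; rewrite !inE ?dom0 // => /allP Px /allP Py.
by apply/allP=> z /domB; rewrite mem_cat => /orP[/Px|/Py].
Qed.

HB.instance Definition _ :=
  GRing.isZmodClosed.Build C1 C1E0 (@dom_all_zmod_closed G [in E0]).
HB.instance Definition _ :=
  GRing.isZmodClosed.Build C2 C2E0 (@dom_all_zmod_closed cell _).

(* C_n(E, E_0) = C_n(E) / C_n(E_0).  Maps out of a quotient are given by their
   value on the representative [repr x]; [boundaryR_pi], [evalR_pi] and [actR_pi]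
   show that the chosen representative does not matter. *)
Definition C1R := {ideal_quot C1E0}.
Definition C2R := {ideal_quot C2E0}.

Definition boundaryR (x : C2R) : C1R := \pi_C1R (boundary (repr x)).

Lemma freegZU (K : choiceType) (c : 'F_2) (b : K) :
  c *: << b >> = << c *g b >> :> {freeg K / 'F_2}.
Proof. by apply/eqP/freeg_eqP=> z; rewrite coeffZ !coeffU mul1r. Qed.

Lemma freegU_C1E0 (c : 'F_2) (a : G) : a \in E0 -> << c *g a >> \in C1E0.
Proof.
move=> aE; rewrite -freegZU inE; apply/allP=> b /domZ_subset.
by rewrite domU1 inE => /eqP->.
Qed.

Lemma boundaryR_pi (x : C2) : boundaryR (\pi x) = \pi_C1R (boundary x).
Proof.
apply/eqP; rewrite /boundaryR -Quotient.idealrBE -[_ - _]raddfB /=.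
have : repr (\pi_C2R x) - x \in C2E0 by rewrite Quotient.idealrBE reprK.
move: (_ - _) => y /allP yE0.
rewrite -[y]freeg_sumE /boundary raddf_sum /= big_seq rpred_sum //.
move=> p /yE0 /and3P[p1 p2 p3]; rewrite liftU !scalerDr !freegZU.
by rewrite !rpredD // freegU_C1E0.
Qed.

(* The linear extension of [g] to C_1(E, E_0), for [g] vanishing on E_0. *)
Definition evalR (g : G -> 'F_2) (x : C1R) : 'F_2 :=
  fglift (g : G -> ('F_2)^o) (repr x).

Lemma evalR_pi (g : G -> 'F_2) : (forall a, a \in E0 -> g a = 0) ->
  forall x : C1, evalR g (\pi x) = fglift (g : G -> ('F_2)^o) x.
Proof.
move=> g0 x; apply/eqP.
rewrite /evalR -subr_eq0 -[_ - _](raddfB (fglift (g : G -> ('F_2)^o))).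
have : repr (\pi_C1R x) - x \in C1E0 by rewrite Quotient.idealrBE reprK.
move: (_ - _) => y /allP yE0.
rewrite -[y]freeg_sumE raddf_sum /= big_seq big1 //.
by move=> p /yE0 /g0 E; rewrite liftU E scaler0.
Qed.

Definition act1C (q : Qgrp G) : C1 -> C1 := fglift (fun a => << act q a >> : C1).
Definition actR (q : Qgrp G) (x : C1R) : C1R := \pi_C1R (act1C q (repr x)).

Definition cell_chain (a b : G) : C2 :=
  if insub (a, b) is Some p then << (p : cell) >> else 0.

(* f_e = sum_i [a_i | b_i] with b_i = a_(i+1) (+) ( ... (+) a_n); here i starts
   at 0, and the last index has no b_i, hence contributes 0. *)
Definition fe : C2R :=
  \pi_C2R (\sum_(i < ninp G)
    if nested_sum (@oplus G) (drop i.+1 (inp G)) is Some b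
    then cell_chain (tnth (inp G) i) b else 0).

Definition dfe : C1R := boundaryR fe.

(* C_1(C_Q), the span of the q * (boundary of f_e); a scalar c q in Z_2 acts on
   the abelian group C_1(E, E_0) through its representative 0 or 1. *)
Definition C1CQ_pred : {pred C1R} := [pred x |
  [exists c : {ffun Qgrp G -> 'F_2}, x == \sum_q actR q dfe *+ c q]].

Lemma E0_act q a : (act q a \in E0) = (a \in E0).
Proof.
apply/existsP/existsP=> -[p /eqP ap].
  by exists (q^-1 * p)%g; rewrite actM -ap -actM mulVg act1.
by exists (q * p)%g; rewrite actM ap.
Qed.

Lemma act1C_U q a : act1C q << a >> = << act q a >>.
Proof. by rewrite /act1C liftU scale1r. Qed.

Lemma act1C_E0 q (x : C1) : x \in C1E0 -> act1C q x \in C1E0.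
Proof.
move=> /allP xE0; rewrite -[x]freeg_sumE /act1C raddf_sum /= big_seq rpred_sum //.
move=> a /xE0 aE0; rewrite liftU inE; apply/allP=> b /domZ_subset.
by rewrite domU1 inE => /eqP->; rewrite E0_act.
Qed.

Lemma actR_pi q (x : C1) : actR q (\pi x) = \pi_C1R (act1C q x).
Proof.
apply/eqP; rewrite /actR -Quotient.idealrBE -[_ - _]raddfB /=.
by apply: act1C_E0; rewrite Quotient.idealrBE reprK.
Qed.

Lemma actR_zmod_morphism q : zmod_morphism (actR q).
Proof.
by elim/quotW=> x; elim/quotW=> y; rewrite -raddfB /= !actR_pi /act1C !raddfB.
Qed.

HB.instance Definition _ q :=
  GRing.isZmodMorphism.Build C1R C1R (actR q) (actR_zmod_morphism q).

Lemma actR_act p q (x : C1R) : actR p (actR q x) = actR (p * q)%g x.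
Proof.
elim/quotW: x => x; rewrite (actR_pi q x) (actR_pi p) (actR_pi (p * q)%g x).
suff -> : act1C p (act1C q x) = act1C (p * q)%g x by [].
rewrite -[x]freeg_sumE /act1C !raddf_sum /=; apply: eq_bigr => a _.
by rewrite !liftU freegZU liftU actM.
Qed.

Lemma C1RB (x y : C1R) : x - y = x + y.
Proof.
elim/quotW: x => x; elim/quotW: y => y; rewrite -raddfB -raddfD /=.
congr \pi; apply/eqP/freeg_eqP=> z.
by rewrite coeffB coeffD oppr_pchar2 // pchar_Fp.
Qed.

Lemma C1CQ_zmod_closed : zmod_closed C1CQ_pred.
Proof.
have add2 (x : C1R) (c d : 'F_2) : x *+ c + x *+ d = x *+ (c + d)%R.
  have x2 : x + x = 0 by rewrite -C1RB subrr.
  case: c d => [[|[|]] // ?] [[|[|]] // ?];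
    by rewrite /= ?mulr0n ?mulr1n ?add0r ?addr0 ?x2.
split=> [|x y].
  apply/existsP; exists [ffun=> 0]; apply/eqP.
  by rewrite big1 // => q _; rewrite ffunE.
move=> /existsP[c /eqP->] /existsP[d /eqP->]; rewrite C1RB.
apply/existsP; exists [ffun q => c q + d q]; apply/eqP.
by rewrite -big_split /=; apply: eq_bigr => q _; rewrite ffunE add2.
Qed.

HB.instance Definition _ := GRing.isZmodClosed.Build C1R C1CQ_pred C1CQ_zmod_closed.

Record C1CQ := SubC1CQ { C1CQ_val :> C1R; _ : C1CQ_val \in C1CQ_pred }.
HB.instance Definition _ := [isSub for C1CQ_val].
HB.instance Definition _ := [Choice of C1CQ by <:].
HB.instance Definition _ := [SubChoice_isSubZmodule of C1CQ by <:].

Lemma actR_C1CQ q (x : C1CQ) : actR q (val x) \in C1CQ_pred.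
Proof.
case: x => x /= /existsP[c /eqP->]; rewrite raddf_sum /=.
apply/existsP; exists [ffun p => c (q^-1 * p)%g]; apply/eqP.
rewrite [RHS](reindex_inj (mulgI q)); apply: eq_bigr => p _.
by rewrite ffunE mulKg -actR_act raddfMn.
Qed.

Definition actCQ (q : Qgrp G) (x : C1CQ) : C1CQ := SubC1CQ (actR_C1CQ q x).

Definition cochain := Qgrp G -> C1CQ -> 'F_2.

Definition coboundary (gamma : {additive C1CQ -> 'F_2}) : cochain :=
  fun q x => gamma (actCQ q x) + gamma x.

(* The class of [Phi] in H^1(Q, C_Q), as a coset of the coboundaries. *)
Definition H1_class (Phi : cochain) : set cochain :=
  [set Psi | exists gamma : {additive C1CQ -> 'F_2},
     Psi = fun q x => Phi q x + coboundary gamma q x].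

(* Extension by zero. *)
Definition ext0 (P : pred G) (f : {a | P a} -> 'F_2) (a : G) : 'F_2 :=
  if insub a is Some x then f x else 0.

Definition output_class (o : Qgrp G -> 'F_2) : set (Qgrp G -> 'F_2) :=
  [set o' | exists (gamma : {a : G | a \notin E0} -> 'F_2) (c : 'F_2),
     o' = fun q => o q + evalR (ext0 gamma) (actR q dfe) + c].

End Chains.

Section Observables.
Variables (R : realType) (d : nat).
Local Notation op := 'M[R[i]]_d.+1.

Definition observable (A : op) : Prop :=
  A \is hermsymmx /\ forall z, eigenvalue A z -> z = 1 \/ z = -1.

(* s = [:: A_1; ...; A_K], with indices shifted to start at 0. *)
Definition resolution (O : set op) (X : op) (s : seq op) : Prop :=
  [/\ s != [::], X = \prod_(A <- s) A, forall A, A \in s -> O A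
    & forall i, (i.+1 < size s)%N ->
        GRing.comm s`_i (\prod_(A <- drop i.+1 s) A)].

Definition inferable (O : set op) : set op :=
  [set X | observable X /\ exists s, resolution O X s].

End Observables.

(* The Hilbert space is C^(hdim+1).  The class {T_a, -T_a} is identified with its
   index a : G, so that E, with its chosen representatives, is the family Trep; the
   group Q is presented as the quotient H / N through a surjective morphism
   [cls] with kernel N. *)
Record HMBQC (R : realType) (G : edge_data) := Hmbqc {
  hdim : nat;
  obs : set 'M[R[i]]_hdim.+1;
  obs_observable : forall A, obs A -> observable A;
  obsN : forall A, obs A <-> obs (- A);

  Trep : G -> 'M[R[i]]_hdim.+1;
  Trep_inferable : forall a, inferable obs (Trep a);
  Trep_surj : forall A, inferable obs A -> exists a, A = Trep a \/ A = - Trep a;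
  Trep_inj : forall a b, Trep a = Trep b \/ Trep a = - Trep b -> a = b;
  EO_Trep : forall a, EO a <-> obs (Trep a);
  oplus_Trep : forall a b c, oplus a b = Some c <->
    [/\ EO a, GRing.comm (Trep a) (Trep b)
      & Trep c = Trep a * Trep b \/ Trep c = - (Trep a * Trep b)];

  Hgrp : groupType;
  hact : Hgrp -> 'M[R[i]]_hdim.+1 -> 'M[R[i]]_hdim.+1;
  hact_inferable : forall h A, inferable obs A -> inferable obs (hact h A);
  hact1 : forall A, inferable obs A -> hact 1%g A = A;
  hactM : forall g h A, inferable obs A -> hact (g * h)%g A = hact g (hact h A);
  hactN : forall h A, inferable obs A -> hact h (- A) = - hact h A;

  cls : {multiplicative Hgrp -> Qgrp G};
  cls_surj : forall q, exists h, cls h = q;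
  cls_ker : forall h, cls h = 1%g <->
    forall a, hact h (Trep a) = Trep a \/ hact h (Trep a) = - Trep a;
  cls_act : forall h a,
    hact h (Trep a) = Trep (act (cls h) a) \/ hact h (Trep a) = - Trep (act (cls h) a);

  output : Qgrp G -> 'F_2;
  Ro : set 'M[R[i]]_hdim.+1 :=
    range (fun q => (-1) ^+ output q *: \prod_(i < ninp G) Trep (act q (tnth (inp G) i)));
  chi : {a : G | a \in @E0 G} -> 'F_2;
  Ro_chi : Ro = range (fun x => (-1) ^+ chi x *: Trep (val x));

  hact_obs : forall h A, obs A -> obs (hact h A);
  hact_mul : forall h A B, inferable obs A -> inferable obs B ->
    GRing.comm A B -> inferable obs (A * B) -> hact h A * hact h B = hact h (A * B);
  hact_Ro : forall h, hact h @` Ro = Ro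
}.

Section PhaseFunction.
Variables (R : realType) (G : edge_data) (M : HMBQC R G).

(* h(T_a) = (-1)^(phase_rep h a) T_(h a), by [cls_act]. *)
Definition phase_rep (h : Hgrp M) (a : G) : 'F_2 :=
  if hact h (Trep M a) == Trep M (act (cls M h) a) then 0 else 1.

Definition phase_chi (h : Hgrp M) (a : G) : 'F_2 :=
  phase_rep h a + ext0 (@chi _ _ M) (act (cls M h) a) + ext0 (@chi _ _ M) a.

(* The value at q does not depend on the chosen preimage of q. *)
Definition Phi : cochain G := fun q x =>
  evalR (phase_chi (sval (cid (cls_surj M q)))) (val x).

End PhaseFunction.

(* Main.v *)
Require Import Defs.
From mathcomp Require Import fingroup.
From mathcomp Require Import all_boot all_order all_algebra.
From mathcomp Require Import generic_quotient boolp classical_sets reals complex.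
From mathcomp Require Import sesquilinear ring.
From mathcomp.multinomials Require Import freeg.

(* Applying h, with class q, to (-1)^(o 1) T_{a_1} ... T_{a_n} and using h(R_o) = R_o
   yields Phi_q(dfe) = o q + o 1.  If Phi = Phi' + d gamma, then evaluating at dfe shows
   that o and o' differ by gamma(q dfe) plus a constant; and gamma, defined only on the
   span of the chains q dfe, extends to a function on E \ E_0 because only finitely many
   edges occur in these chains. *)

Set Implicit Arguments.
Unset Strict Implicit.
Unset Printing Implicit Defensive.

Import GRing.Theory.

Local Open Scope ring_scope.
Local Open Scope quotient_scope.

(** * Characteristic-two arithmetic *)

Lemma addFF2 (x : 'F_2) : x + x = 0.
Proof. by rewrite addrr_pchar2 // pchar_Fp. Qed.

Lemma addF2_eq0 (x y : 'F_2) : (x + y == 0) = (x == y).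
Proof. by rewrite addr_eq0 oppr_pchar2 // pchar_Fp. Qed.

Lemma mulrnF2 (x c : 'F_2) : x *+ c = x * c.
Proof. by rewrite -mulr_natr natr_Zp. Qed.

Lemma addC1C1 (G : edge_data) (x : C1 G) : x + x = 0.
Proof. by apply/eqP/freeg_eqP => z; rewrite coeffD coeff0 addFF2. Qed.

(** * The relative boundary of [fe] and its translates under Q *)

Section Chains.
Variable G : edge_data.
Implicit Types (a b c : G) (s : seq G) (g : G -> 'F_2) (q : Qgrp G).

Lemma boundary_cell a b c : oplus a b = Some c ->
  boundary (cell_chain a b) = << a >> + << b >> + << c >> :> C1 G.
Proof.
move=> abc; rewrite /cell_chain; case: insubP => [p _ vp|]; last by rewrite /= abc.
by rewrite /boundary liftU scale1r /cell_sum vp /= abc.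
Qed.

(** Telescoping: each cell contributes a_i + b_i + b_(i-1), where b_0 = c, and the intermediate sums
    b_i cancel in pairs modulo 2. *)
Lemma boundary_nested_sum x0 s c : nested_sum (@oplus G) s = Some c ->
  \sum_(i < size s)
    boundary (if nested_sum (@oplus G) (drop i.+1 s) is Some b
              then cell_chain (nth x0 s i) b else 0) =
  \sum_(a <- s) << a >> + << c >> :> C1 G.
Proof.
elim: s c => [//|a [|a' s] IH] c.
  (* For one edge the only index has no tail, so the left side is the default 0, while the right
     side is a + a. *)
  by case=> <-; rewrite big_ord1 big_seq1 addC1C1 /boundary raddf0.
rewrite /= -/(nested_sum _ (a' :: s)).
case E : (nested_sum _ (a' :: s)) => [b|//] /= abc.
rewrite big_ord_recl drop0 E (boundary_cell abc) big_cons.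
rewrite [X in _ + X](IH _ E : _ = \sum_(a <- a' :: s) << a >> + << b >> :> C1 G).
rewrite -!addrA; congr (_ + _); rewrite [RHS]addrC addrCA.
by rewrite [<< b >> + _]addrCA addC1C1 addr0.
Qed.

Lemma mem_ae_E0 : ae G \in @E0 G.
Proof. by apply/existsP; exists 1%g; rewrite act1. Qed.

Lemma inp_act_notin_E0 q i : act q (tnth (inp G) i) \notin @E0 G.
Proof.
rewrite E0_act; apply/existsPn => p; exact: inp_notin_E0.
Qed.

(** The remaining term a_e of the telescoped boundary lies in E_0, so it dies in the quotient. *)
Lemma dfeE : dfe G = \pi_(C1R G) (\sum_(i < ninp G) << tnth (inp G) i >>).
Proof.
rewrite /dfe /fe boundaryR_pi /boundary raddf_sum /=.
transitivity (\pi_(C1R G) (\sum_(a <- inp G) << a >> + << ae G >> : C1 G)).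
  congr \pi; rewrite -(boundary_nested_sum (ae G) (inp_sum G)) size_tuple.
  by apply: eq_bigr => i _; rewrite (tnth_nth (ae G)).
rewrite big_tuple raddfD /=.
have -> : \pi_(C1R G) (<< ae G >> : C1 G) = 0.
  rewrite -[0](raddf0 (\pi_(C1R G))); apply/eqP; rewrite -Quotient.idealrBE subr0.
  exact/freegU_C1E0/mem_ae_E0.
by rewrite addr0.
Qed.

Lemma actR_dfe q :
  actR q (dfe G) = \pi_(C1R G) (\sum_(i < ninp G) << act q (tnth (inp G) i) >>).
Proof.
rewrite dfeE actR_pi /act1C raddf_sum /=; congr \pi.
by apply: eq_bigr => i _; rewrite liftU scale1r.
Qed.

Lemma evalR_actR_dfe g q : (forall a, a \in @E0 G -> g a = 0) ->
  evalR g (actR q (dfe G)) = \sum_(i < ninp G) g (act q (tnth (inp G) i)).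
Proof.
move=> g0; rewrite actR_dfe evalR_pi // raddf_sum /=.
by apply: eq_bigr => i _; rewrite liftU scale1r.
Qed.

Lemma actR1 (x : C1R G) : actR 1%g x = x.
Proof.
elim/quotW: x => x; rewrite actR_pi; congr \pi.
rewrite -[x in RHS]freeg_sumE -[x in LHS]freeg_sumE /act1C raddf_sum /=.
by apply: eq_bigr => a _; rewrite liftU freegZU act1.
Qed.

End Chains.

(** * Signs of operators, and observables up to sign *)

Section Signs.
Variables (R : realType) (d : nat).
Local Notation op := 'M[R[i]]_d.+1.
Implicit Types (A B T : op) (e f : 'F_2) (O : set op).

Lemma signF2D e f : (-1) ^+ (e + f)%R = (-1) ^+ e * (-1) ^+ f :> R[i].
Proof.
by case: e f => [[|[|]] // ?] [[|[|]] // ?];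
  rewrite /= ?expr0 ?expr1 ?mulrNN ?mulr1 ?mul1r.
Qed.

Lemma signF2P A B : A = B \/ A = - B <-> exists e, A = (-1) ^+ e *: B.
Proof.
split=> [[->|->]|[e ->]].
- by exists 0; rewrite scale1r.
- by exists 1; rewrite scaleN1r.
- case: e => [[|[|]] // ?] /=; first by left; rewrite scale1r.
  by right; rewrite scaleN1r.
Qed.

Lemma signF2_inj e f T : T != 0 -> (-1) ^+ e *: T = (-1) ^+ f *: T -> e = f.
Proof.
move=> T0 eq_ef; apply/eqP; rewrite -addF2_eq0.
have : (-1) ^+ (e + f)%R *: T = T.
  by rewrite signF2D mulrC -scalerA eq_ef scalerA -signF2D addFF2 scale1r.
case: (e + f) => [[|[|]] // ?] //= /eqP.
(* If the signs differed, then - T = T, so 2 T = 0, impossible over the complex numbers for nonzero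
   T. *)
rewrite expr1 scaleN1r -subr_eq0 -opprD oppr_eq0 -mulr2n -scaler_nat.
by rewrite scaler_eq0 Num.Theory.pnatr_eq0 (negPf T0).
Qed.

Lemma observable_neq0 A : observable A -> A != 0.
Proof.
move=> [_ Aev]; apply/eqP => A0.
have /Aev : eigenvalue A 0.
  apply/eigenvalueP; exists (const_mx 1); first by rewrite A0 mulmx0 scale0r.
  by apply/eqP => /matrixP /(_ 0 0) /eqP; rewrite !mxE oner_eq0.
by case=> /eqP; rewrite eq_sym ?oppr_eq0 oner_eq0.
Qed.

Lemma observableN A : observable A -> observable (- A).
Proof.
move=> [Aherm Aev]; split.
  move/is_hermitianmxP: Aherm => Aherm; apply/is_hermitianmxP.
  by rewrite linearN /= map_mxN scalerN -Aherm.
move=> z /eigenvalueP[v vA v0].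
have /Aev : eigenvalue A (- z).
  by apply/eigenvalueP; exists v; rewrite // scaleNr -vA mulmxN opprK.
by case=> /eqP; rewrite eqr_oppLR ?opprK => /eqP ->; [right|left].
Qed.

(** Negating only the first factor of a resolution keeps every tail product, and a sign does not
    affect commutation. *)
Lemma inferableN O A : (forall B, O B -> O (- B)) ->
  inferable O A -> inferable O (- A).
Proof.
move=> ON [Aobs [s [s0 As sO scomm]]].
case: s s0 As sO scomm => [/eqP[]|B s _ As sO scomm]; first by [].
split; first exact: observableN.
exists (- B :: s); split; first by [].
- by rewrite As !big_cons mulNr.
- move=> C; rewrite inE => /predU1P[->|Cs]; first by apply/ON/sO; rewrite mem_head.
  by apply: sO; rewrite inE Cs orbT.
- case=> [|i] si; last exact: (scomm i.+1).
  apply/commr_sym/commrN/commr_sym; exact: (scomm 0).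
Qed.

Lemma inferable_sign O A e : (forall B, O B -> O (- B)) ->
  inferable O A -> inferable O ((-1) ^+ e *: A).
Proof.
move=> ON Ainf.
have [->//|->] : (-1) ^+ e *: A = A \/ (-1) ^+ e *: A = - A.
  by apply/signF2P; exists e.
exact: inferableN.
Qed.

End Signs.

(** * The phase function on [dfe] in terms of the output function *)

Section OutputPhase.
Variables (R : realType) (G : edge_data) (M : HMBQC R G).
Implicit Types (a b c : G) (h : Hgrp M) (q : Qgrp G).
Local Notation T := (Trep M).
Local Notation chi0 := (ext0 (@chi _ _ M)).

Lemma Trep_neq0 a : T a != 0.
Proof. by have [/observable_neq0] := Trep_inferable M a. Qed.

Lemma inferable_sign_Trep (e : 'F_2) a : inferable (@obs _ _ M) ((-1) ^+ e *: T a).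
Proof.
apply: inferable_sign; last exact: Trep_inferable.
by move=> B; have [] := @obsN _ _ M B.
Qed.

Lemma sign_Trep_inj (e f : 'F_2) a b :
  (-1) ^+ e *: T a = (-1) ^+ f *: T b -> a = b /\ e = f.
Proof.
move=> eq_ab; suff ab : a = b.
  by subst b; split=> //; apply: signF2_inj eq_ab; apply: Trep_neq0.
apply: (@Trep_inj _ _ M); apply/signF2P; exists (e + f).
by rewrite signF2D -scalerA -eq_ab scalerA -signF2D addFF2 scale1r.
Qed.

Lemma hact_Trep h (e : 'F_2) a :
  hact h ((-1) ^+ e *: T a) = (-1) ^+ (e + phase_rep h a)%R *: T (act (cls M h) a).
Proof.
have hT : hact h (T a) = (-1) ^+ phase_rep h a *: T (act (cls M h) a).
  rewrite /phase_rep; case: eqP => [->|neq]; first by rewrite scale1r.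
  by case: (cls_act h a) => // ->; rewrite scaleN1r.
rewrite signF2D -scalerA -hT.
case: e => [[|[|]] // ?] /=; first by rewrite !scale1r.
by rewrite !scaleN1r hactN //; apply: Trep_inferable.
Qed.

(** The first conjunct carries the induction: each tail product is a signed T_b, hence inferable and
    commuting with the preceding factor, as multiplicativity of h requires. *)
Lemma hact_prod_Trep h (s : seq G) c : nested_sum (@oplus G) s = Some c ->
  (exists e : 'F_2, \prod_(a <- s) T a = (-1) ^+ e *: T c) /\
  hact h (\prod_(a <- s) T a) =
    (-1) ^+ (\sum_(a <- s) phase_rep h a)%R *: \prod_(a <- s) T (act (cls M h) a).
Proof.
have hT a : hact h (T a) = (-1) ^+ phase_rep h a *: T (act (cls M h) a).
  by rewrite -[T a]scale1r -[1](expr0 (-1)) (hact_Trep h 0) add0r.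
elim: s c => [//|a [|a' s] IH] c.
  case=> <-; rewrite !big_seq1; split; last exact: hT.
  by exists 0; rewrite scale1r.
rewrite /= -/(nested_sum _ (a' :: s)).
case E : (nested_sum _ (a' :: s)) => [b|//] /= /(oplus_Trep M)[_ Cab Tc].
have [[e es] hs] := IH _ E.
have [f ef] : exists f : 'F_2, T a * T b = (-1) ^+ f *: T c.
  apply/signF2P; case: Tc => ->; [by left|by right; rewrite opprK].
have prodE : T a * \prod_(a <- a' :: s) T a = (-1) ^+ (e + f)%R *: T c.
  by rewrite es -scalerAr ef scalerA signF2D.
rewrite ![\big[_/_]_(_ <- a :: _) _]big_cons; split; first by exists (e + f).
rewrite -hact_mul.
- by rewrite hs hT -scalerAl -scalerAr scalerA signF2D.
- exact: Trep_inferable.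
- by rewrite es; apply: inferable_sign_Trep.
- by rewrite es /GRing.comm -scalerAr -scalerAl Cab.
- by rewrite prodE; apply: inferable_sign_Trep.
Qed.

Lemma mem_Ro_chi a : a \in @E0 G -> @Ro _ _ M ((-1) ^+ chi0 a *: T a).
Proof.
move=> aE; rewrite Ro_chi; exists (Sub a aE) => //=.
by rewrite /ext0 insubT.
Qed.

(** Each T_x with x in E_0 occurs in R_o with one sign only, so membership in R_o determines the
    sign. *)
Lemma Ro_sign (e : 'F_2) a : @Ro _ _ M ((-1) ^+ e *: T a) -> e = chi0 a.
Proof.
rewrite Ro_chi => -[x _ /sign_Trep_inj[<- <-]].
by rewrite /ext0 valK.
Qed.

(** Since h preserves R_o, it sends (-1)^chi(a) T_a to (-1)^chi(ha) T_(ha); comparing signs gives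
    the vanishing. *)
Lemma phase_chi_E0 h a : a \in @E0 G -> phase_chi h a = 0.
Proof.
move=> /mem_Ro_chi aRo.
have : @Ro _ _ M (hact h ((-1) ^+ chi0 a *: T a)) 
  by rewrite -(hact_Ro h); exists ((-1) ^+ chi0 a *: T a).
rewrite hact_Trep => /Ro_sign hchi.
by rewrite /phase_chi -hchi -addrA [_ + chi0 a]addrAC addFF2 add0r addFF2.
Qed.

Lemma phase_chi_inp h i : phase_chi h (tnth (inp G) i) = phase_rep h (tnth (inp G) i).
Proof.
have := inp_act_notin_E0 1%g i; rewrite /phase_chi /ext0 act1 => ?.
by rewrite !insubN ?inp_act_notin_E0 // !addr0.
Qed.

Lemma output_phase_rep h :
  \sum_(i < ninp G) phase_rep h (tnth (inp G) i) = output M (cls M h) + output M 1%g.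
Proof.
have [[e]] := hact_prod_Trep h (inp_sum G).
rewrite !big_tuple => es; set p := \sum_(i < _) _.
rewrite es; set P := \prod_(i < _) _ => hP.
have oRo q : @Ro _ _ M
    ((-1) ^+ output M q *: \prod_(i < ninp G) T (act q (tnth (inp G) i))).
  by exists q.
(* Here [e] is the sign of T_(a_1) ... T_(a_n) relative to T_(a_e); the element of R_o at q = 1
   fixes chi(a_e). *)
have o1 : output M 1%g + e = chi0 (ae G).
  apply: Ro_sign; rewrite signF2D -scalerA -es; move: (oRo 1%g).
  by under eq_bigr do rewrite act1.
(* Two evaluations of h on the product are compared: factor by factor, and through a_e. The
   resulting sign of [P] determines chi(h a_e). *)
have PE : P = (-1) ^+ (p + (e + phase_rep h (ae G)))%R *: T (act (cls M h) (ae G)).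
  by rewrite signF2D -scalerA -hact_Trep hP scalerA -signF2D addFF2 scale1r.
have := oRo (cls M h); rewrite -/P PE scalerA -signF2D => /Ro_sign oh.
have := phase_chi_E0 h (mem_ae_E0 G); rewrite /phase_chi -oh -o1.
set o := output _ _; set r := phase_rep _ _; set o' := output _ _ => /eqP.
have -> : r + (o + (p + (e + r))) + (o' + e) = (r + r) + (e + e) + (o + o' + p) by ring.
by rewrite !addFF2 !add0r addF2_eq0 => /eqP.
Qed.

Lemma Phi_dfe q (x : C1CQ G) : val x = dfe G ->
  Phi M q x = output M q + output M 1%g.
Proof.
move=> xE; rewrite /Phi; case: cid => h /= <-; rewrite xE -[dfe G]actR1.
rewrite evalR_actR_dfe; last exact: phase_chi_E0.
by rewrite -output_phase_rep; apply: eq_bigr => i _; rewrite act1 phase_chi_inp.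
Qed.

End OutputPhase.

(** * Extension of functionals and classes of output functions *)

Section OutputClass.
Variable G : edge_data.
Implicit Types (a : G) (q : Qgrp G).

Lemma dfe_C1CQ : dfe G \in @C1CQ_pred G.
Proof.
apply/existsP; exists [ffun q => (q == 1%g)%:R].
rewrite (bigD1 1%g) //= big1 => [|q /negPf q1]; last by rewrite ffunE q1.
by rewrite ffunE eqxx addr0 mulr1n actR1.
Qed.

Definition dfeCQ : C1CQ G := SubC1CQ dfe_C1CQ.

(** The values of g on the finite set [S] of edges occurring in the translates of [dfe] must solve
    the linear system u W = v over F_2; elsewhere g is 0. *)
Lemma extend_C1CQ_functional (gamma : {additive C1CQ G -> 'F_2}) :
  exists g : {a : G | a \notin @E0 G} -> 'F_2,
    forall q, gamma (actCQ q dfeCQ) = evalR (ext0 g) (actR q (dfe G)).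
Proof.
have gammaMn (x : C1CQ G) (c : 'F_2) : gamma (x *+ c) = gamma x * c.
  by rewrite -mulrnF2; apply: (raddfMn gamma).
pose n := #|Qgrp G|; pose Q (p : 'I_n) : Qgrp G := enum_val p.
pose s := [seq act q (tnth (inp G) i) | q <- enum (Qgrp G), i <- enum 'I_(ninp G)].
have s_inp q i : act q (tnth (inp G) i) \in s.
  by apply: allpairs_f; rewrite mem_enum.
pose S := undup s.
(* Column [p] lists the coefficients of the chain q [dfe], for the p-th q, on the edges of [S]. *)
pose W := \matrix_(j < size S, p < n)
  (\sum_(i < ninp G) (act (Q p) (tnth (inp G) i) == nth (ae G) S j)%:R : 'F_2).
pose v := \row_(p < n) gamma (actCQ (Q p) dfeCQ).
(* A linear relation among the chains [q dfe] is one among the values [v] of [gamma]. *)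
have vW : (v <= W)%MS.
  rewrite submxE; apply/eqP/matrixP => i0 k; rewrite !mxE.
  transitivity (gamma (\sum_p actCQ (Q p) dfeCQ *+ cokermx W p k)).
    by rewrite raddf_sum; apply: eq_bigr => p _; rewrite gammaMn mxE.
  rewrite [X in gamma X](_ : _ = 0) ?raddf0 //; apply: val_inj.
  rewrite raddf_sum raddf0.
  transitivity (\pi_(C1R G)
    (\sum_p (\sum_(i < ninp G) << act (Q p) (tnth (inp G) i) >>) *+ cokermx W p k)).
    rewrite (raddf_sum (\pi_(C1R G))); apply: eq_bigr => p _.
    by rewrite raddfMn [RHS](raddfMn (\pi_(C1R G))); congr (_ *+ _); apply: actR_dfe.
  rewrite -[RHS](raddf0 (\pi_(C1R G))); congr \pi.
  apply/eqP/freeg_eqP => a; rewrite coeff0 raddf_sum /=.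
  under eq_bigr => p _ do rewrite coeffMn raddf_sum /= mulrnF2.
  (* The coefficient at an edge of [S] is an entry of W times its cokernel, hence 0; no other edge
     occurs. *)
  have [aS|aS] := boolP (a \in S); last first.
    rewrite big1 // => p _; rewrite big1 ?mul0r // => i _.
    rewrite coeffU mul1r; case: eqP => // ia.
    by rewrite mem_undup -ia s_inp in aS.
  have aS' := aS; rewrite -index_mem in aS'.
  transitivity ((W *m cokermx W) (Ordinal aS') k); last by rewrite mulmx_coker mxE.
  rewrite mxE. apply: eq_bigr => p _; congr (_ * _); rewrite mxE.
  by apply: eq_bigr => i _; rewrite coeffU mul1r /= nth_index.
have [u vE] := submxP vW.
(* Outside [S] the index equals [size S], so [insub] fails and the value is 0. *)
pose g a : 'F_2 := if insub (index a S) is Some j then u 0 j else 0.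
exists (g \o val) => q; rewrite evalR_actR_dfe; last first.
  by move=> a aE; rewrite /ext0 insubN // negbK.
have -> : gamma (actCQ q dfeCQ) = v 0 (enum_rank q) by rewrite mxE /Q enum_rankK.
rewrite vE mxE; under eq_bigr => j _ do rewrite mxE big_distrr /=.
rewrite exchange_big; apply: eq_bigr => i _ /=.
rewrite /ext0 (insubT (fun a => a \notin @E0 G) (inp_act_notin_E0 q i)) /= /g.
have qS : (index (act q (tnth (inp G) i)) S < size S)%N.
  by rewrite index_mem mem_undup.
rewrite (insubT (fun j => j < size S)%N qS) (bigD1 (Ordinal qS)) //=.
rewrite nth_index; last by rewrite mem_undup.
rewrite /Q enum_rankK eqxx mulr1 big1 ?addr0 // => j jq.
case: eqP => [aj|]; last by rewrite mulr0.
by case/eqP: jq; apply/val_inj; rewrite /= aj index_uniq ?undup_uniq.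
Qed.

(** The allowed modifications are closed under addition, and in characteristic 2 the same shift by g
    and c serves both inclusions. *)
Lemma output_class_shift (o o' : Qgrp G -> 'F_2)
    (g : {a : G | a \notin @E0 G} -> 'F_2) (c : 'F_2) :
  (forall q, o q = o' q + evalR (ext0 g) (actR q (dfe G)) + c) ->
  output_class o = output_class o'.
Proof.
have evE (f : {a | a \notin @E0 G} -> 'F_2) q : evalR (ext0 f) (actR q (dfe G)) =
    \sum_(i < ninp G) ext0 f (act q (tnth (inp G) i)).
  by apply: evalR_actR_dfe => a aE; rewrite /ext0 insubN // negbK.
have extD (f f' : {a | a \notin @E0 G} -> 'F_2) q :
    evalR (ext0 (fun x => f x + f' x)) (actR q (dfe G)) =
    evalR (ext0 f) (actR q (dfe G)) + evalR (ext0 f') (actR q (dfe G)).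
  rewrite !evE -big_split /=.
  apply: eq_bigr => i _; rewrite /ext0; case: insubP => //=; by rewrite addr0.
move=> oE; apply/seteqP; split=> _ [f [k ->]].
  exists (fun x => f x + g x), (k + c); apply/funext => q.
  by rewrite extD oE; ring.
exists (fun x => f x + g x), (k + c); apply/funext => q; rewrite extD oE.
set e := evalR (ext0 g) _.
have -> : o' q + e + c + (evalR (ext0 f) (actR q (dfe G)) + e) + (k + c) =
   (e + e) + (c + c) + (o' q + evalR (ext0 f) (actR q (dfe G)) + k) by ring.
by rewrite !addFF2 !add0r.
Qed.

End OutputClass.

Theorem corollary2 (R : realType) (G : edge_data) (M M' : HMBQC R G) :
  H1_class (Phi M) = H1_class (Phi M') ->
  output_class (output M) = output_class (output M').
Proof.
move=> PhiE.
have : H1_class (Phi M) (Phi M).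
  exists \0; apply/funext => q; apply/funext => x.
  by rewrite /coboundary /= !addr0.
rewrite PhiE => -[gamma Phi_gamma].
have [g gE] := extend_C1CQ_functional gamma.
(* The constant is read off from o(q) + o(1) = o'(q) + o'(1) + gamma(q dfe) + gamma(dfe). *)
apply: (output_class_shift (g := g)
  (c := output M 1%g + output M' 1%g + gamma (dfeCQ G))) => q.
have := congr1 (fun F => F q (dfeCQ G)) Phi_gamma.
rewrite /= !(Phi_dfe _ _ (erefl : val (dfeCQ G) = dfe G)) /coboundary gE => H.
have -> : output M q = output M q + output M 1%g + output M 1%g.
  by rewrite -addrA addFF2 addr0.
by rewrite H; ring.
Qed.
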